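(* Let $E$ be a congruence on $\overline{\boldsymbol{T}(X_1,\ldots,X_n)}$. If $E$ is finitely generated as a congruence, then so is $\boldsymbol{E}(\boldsymbol{V}(E))$.
   Context: The tropical semifield is $\boldsymbol{T}=\mathbb{R}\cup\{-\infty\}$ with $a\oplus b=\max\{a,b\}$ and $a\odot b=a+b$ (and $a\oplus(-\infty)=a$, $a\odot(-\infty)=-\infty$); its zero is $-\infty$ and its one is $0$. $\boldsymbol{T}[X_1,\ldots,X_n]$ is the semiring of (formal) tropical polynomials. $\overline{\boldsymbol{T}[X_1,\ldots,X_n]}$ is its quotient identifying two tropical polynomials when they define the same function on $\boldsymbol{T}^n$; it is cancellative, and its semifield of fractions is the tropical rational function semifield $\overline{\boldsymbol{T}(X_1,\ldots,X_n)}$. An element $f\neq-\infty$ is of the form $f_1\odot f_2^{\odot(-1)}$ with $f_1,f_2\in\overline{\boldsymbol{T}[X_1,\ldots,X_n]}\setminus\{-\infty\}$ and defines a function $\mathbb{R}^n\to\mathbb{R}$, $f(x)=f_1(x)-f_2(x)$; the element $-\infty$ defines the constant function $-\infty$. A congruence on a semiring $S$ is a subset $E\subset S\times S$ that is an equivalence relation on $S$ and is closed under componentwise addition and multiplication. It is finitely generated if it is the smallest congruence containing some finite subset of it. For $V\subset\mathbb{R}^n$, $\boldsymbol{E}(V)=\{(f,g)\in\overline{\boldsymbol{T}(X_1,\ldots,X_n)}^2 \mid f(x)=g(x)\text{ for all }x\in V\}$. For $E\subset\overline{\boldsymbol{T}(X_1,\ldots,X_n)}^2$, the congruence variety associated with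 $E$ is $\boldsymbol{V}(E)=\{x\in\mathbb{R}^n\mid f(x)=g(x)\text{ for all }(f,g)\in E\}$. *)

(* Defs.v *)
From HB Require Import structures.
From mathcomp Require Import all_boot all_order all_algebra.
From mathcomp Require Import all_classical all_reals ring.

Set Implicit Arguments.
Unset Strict Implicit.
Unset Printing Implicit Defensive.

Import Order.TTheory GRing.Theory Num.Theory.

Local Open Scope ring_scope.
Local Open Scope classical_set_scope.
Local Open Scope quotient_scope.

(* The tropical semifield: [None] is -oo and [Some a] is the real number [a].
   As a semiring, its [+%R] is max, its [*%R] is the addition of reals, its [0]
   is -oo and its [1] is [Some 0].                                           *)
Definition trop (R : realType) := option R.

Section Trop.
Variable R : realType.
Implicit Types a b c : trop R.

HB.instance Definition _ := Choice.on (trop R).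

Definition trop_add a b : trop R :=
  match a, b with
  | None, _ => b
  | _, None => a
  | Some x, Some y => Some (Num.max x y)
  end.

Definition trop_mul a b : trop R :=
  match a, b with
  | Some x, Some y => Some (x + y)
  | _, _ => None
  end.

Definition trop_inv a : trop R := omap -%R a.

Fact trop_addA : associative trop_add.
Proof. by move=> [a|] [b|] [c|] //=; rewrite maxA. Qed.
Fact trop_addC : commutative trop_add.
Proof. by move=> [a|] [b|] //=; rewrite maxC. Qed.
Fact trop_add0 : left_id None trop_add.
Proof. by []. Qed.
Fact trop_mulA : associative trop_mul.
Proof. by move=> [a|] [b|] [c|] //=; rewrite addrA. Qed.
Fact trop_mulC : commutative trop_mul.
Proof. by move=> [a|] [b|] //=; rewrite addrC. Qed.
Fact trop_mul1 : left_id (Some 0) trop_mul.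
Proof. by move=> [a|] //=; rewrite add0r. Qed.
Fact trop_mulDl : left_distributive trop_mul trop_add.
Proof. by move=> [a|] [b|] [c|] //=; rewrite addr_maxl. Qed.
Fact trop_mul0 : left_zero None trop_mul.
Proof. by []. Qed.

HB.instance Definition _ :=
  GRing.isNmodule.Build (trop R) trop_addA trop_addC trop_add0.
HB.instance Definition _ := GRing.Nmodule_isComNzSemiRing.Build (trop R)
  trop_mulA trop_mulC trop_mul1 trop_mulDl trop_mul0 isT.

Lemma trop_mul_eq0 a b : (a * b == 0) = (a == 0) || (b == 0).
Proof. by case: a b => [a|] [b|]. Qed.

Lemma trop_add_eq0 a b : (a + b == 0) = (a == 0) && (b == 0).
Proof. by case: a b => [a|] [b|]. Qed.

Lemma trop_mulfI a : a != 0 -> injective ( *%R a).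
Proof.
case: a => [a|] // _ [b|] [c|] //= [] E.
by congr Some; apply: (addrI a).
Qed.

Lemma trop_mulfV a : a != 0 -> a * trop_inv a = 1.
Proof. by case: a => [a|] // _; congr Some; rewrite subrr. Qed.

Lemma trop_invM a b : trop_inv (a * b) = trop_inv a * trop_inv b.
Proof. by case: a b => [a|] [b|] //=; congr Some; rewrite opprD. Qed.

Lemma trop_exp_eq0 a k : a != 0 -> a ^+ k != 0.
Proof.
by move=> a0; elim: k => [//|k IH]; rewrite exprS trop_mul_eq0 negb_or a0.
Qed.

Lemma trop_sum_neq0 (I : finType) (F : I -> trop R) :
  reflect (exists i, F i != 0) (\sum_i F i != 0).
Proof.
apply: (iffP idP) => [|[i Fi]]; last first.
  by rewrite (bigD1 i) //= trop_add_eq0 negb_and Fi.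
have [/existsP[i Fi] _|/existsPn F0] := boolP [exists i, F i != 0].
  by exists i.
by rewrite big1 ?eqxx // => i _; apply/eqP; move: (F0 i); rewrite negbK.
Qed.

End Trop.

(* Formal tropical polynomials in X_1, ..., X_n, obtained by iterating the
   univariate construction: the outermost variable of [tpoly R n.+1] is X_1
   (index [ord0]), and its coefficients are polynomials in X_2, ..., X_(n+1)
   (indices [lift ord0 i]).                                                  *)
Fixpoint tpoly (R : realType) (n : nat) : comNzSemiRingType :=
  if n is m.+1 then {poly tpoly R m} else trop R.

Fixpoint tpeval (R : realType) (n : nat) :
    tpoly R n -> ('I_n -> trop R) -> trop R :=
  match n return tpoly R n -> ('I_n -> trop R) -> trop R with
  | 0 => fun p _ => p
  | m.+1 => fun p u =>
      (map_poly (fun q => tpeval q (fun i => u (lift ord0 i))) p).[u ord0]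
  end.

Section Tpoly.
Variable R : realType.

Lemma tpeval_rmorph n (u : 'I_n -> trop R) :
  {g : {rmorphism tpoly R n -> trop R} | (fun p => tpeval p u) =1 g}.
Proof.
elim: n u => [|n IH] u; first by exists idfun.
have [g gE] := IH (fun i => u (lift ord0 i)).
have cu : commr_rmorph g (u ord0) by move=> x; exact: mulrC.
by exists (horner_morph cu) => p /=; rewrite /horner_morph (eq_map_poly gE).
Qed.

Lemma tpevalD n (p q : tpoly R n) u : tpeval (p + q) u = tpeval p u + tpeval q u.
Proof. by have [g gE] := tpeval_rmorph u; rewrite !gE rmorphD. Qed.
Lemma tpevalM n (p q : tpoly R n) u : tpeval (p * q) u = tpeval p u * tpeval q u.
Proof. by have [g gE] := tpeval_rmorph u; rewrite !gE rmorphM. Qed.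
Lemma tpeval0 n u : tpeval (0 : tpoly R n) u = 0.
Proof. by have [g gE] := tpeval_rmorph u; rewrite !gE rmorph0. Qed.
Lemma tpeval1 n u : tpeval (1 : tpoly R n) u = 1.
Proof. by have [g gE] := tpeval_rmorph u; rewrite !gE rmorph1. Qed.

Lemma tpevalS n (p : tpoly R n.+1) u :
  tpeval p u = \sum_(i < size (p : {poly tpoly R n}))
    tpeval ((p : {poly tpoly R n})`_i) (fun i => u (lift ord0 i)) * u ord0 ^+ i.
Proof.
by rewrite /= /map_poly horner_poly.
Qed.

Definition fin_pt n (u : 'I_n -> trop R) := forall i, u i != 0.

Lemma tpeval_neq0 n (p : tpoly R n) u v :
  tpeval p u != 0 -> fin_pt v -> tpeval p v != 0.
Proof.
elim: n p u v => [//|n IH] p u v; rewrite !tpevalS => /trop_sum_neq0[i].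
rewrite trop_mul_eq0 negb_or => /andP[pi _] fv.
apply/trop_sum_neq0; exists i.
rewrite trop_mul_eq0 negb_or trop_exp_eq0 // andbT.
by apply: IH pi _ => j; exact: fv.
Qed.

Fixpoint tpolyC n : trop R -> tpoly R n :=
  match n return trop R -> tpoly R n with
  | 0 => id
  | m.+1 => fun c => (tpolyC m c)%:P
  end.

Lemma tpevalC n c u : tpeval (tpolyC n c) u = c.
Proof.
elim: n u => [//|n IH] u /=.
have [g gE] := tpeval_rmorph (fun i => u (lift ord0 i)).
rewrite (eq_map_poly gE) map_polyC hornerC.
exact: etrans (esym (gE _)) (IH _).
Qed.

Lemma tpeval_horner n (p : tpoly R n.+1) c u :
  u ord0 = c ->
  tpeval ((p : {poly tpoly R n}).[tpolyC n c]) (fun i => u (lift ord0 i)) =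
  tpeval p u.
Proof.
move=> uc; have [g gE] := tpeval_rmorph (fun i => u (lift ord0 i)).
rewrite gE -horner_map /=.
have -> : g (tpolyC n c) = c by exact: etrans (esym (gE _)) (tpevalC _ _).
by rewrite -(eq_map_poly gE) uc.
Qed.

Lemma trop_sum_lt (a : nat -> trop R) (b : R) k : exists t0 : R,
  forall t, t <= t0 -> exists2 s, s < b &
    \sum_(i < k) a i * (Some t : trop R) ^+ i.+1 + Some s = Some s.
Proof.
elim: k => [|k [t0 IH]].
  by exists 0 => t _; exists (b - 1); rewrite ?big_ord0 ?add0r // gtrBl.
case ak: (a k) => [x|]; last first.
  exists t0 => t /IH[s sb sE]; exists s => //.
  by rewrite big_ord_recr /= ak mul0r addr0.
have expE (t : R) j : t <= 0 -> exists2 y, y <= t &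
    (Some t : trop R) ^+ j.+1 = Some y.
  move=> t_le0; elim: j => [|j [y yt jE]]; first by exists t => //; rewrite expr1.
  by exists (t + y); [rewrite -[leRHS]addr0 lerD2l (le_trans yt)|rewrite exprS jE].
exists (Num.min t0 (Num.min 0 (b - x - 1))) => t.
rewrite !le_min => /and3P[/IH[s sb sE] t0le tle].
have [y yt yE] := expE t k t0le.
exists (Num.max s (x + y)).
  rewrite gt_max sb /= (le_lt_trans (_ : _ <= x + t)) ?lerD2l //.
  rewrite (le_lt_trans (_ : _ <= x + (b - x - 1))) ?lerD2l //.
  by rewrite addrA subrKC gtrBl.
have -> : Some (Num.max s (x + y)) = (Some s : trop R) + (Some (x + y) : trop R) by [].
rewrite big_ord_recr /= ak yE.
have -> : (Some x : trop R) * (Some y : trop R) = (Some (x + y) : trop R) by [].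
rewrite addrAC addrA sE -addrA.
by congr (_ + _); rewrite /GRing.add /= maxxx.
Qed.

Lemma tpeval_coef0 n (p q : {poly tpoly R n}) u :
  (forall t : R, \sum_(i < size p) tpeval p`_i u * (Some t : trop R) ^+ i =
    \sum_(i < size q) tpeval q`_i u * (Some t : trop R) ^+ i) ->
  tpeval p`_0 u = tpeval q`_0 u.
Proof.
pose k := maxn (size p) (size q).
have widen (r : {poly tpoly R n}) (t : R) : (size r <= k)%N ->
    \sum_(i < size r) tpeval r`_i u * (Some t : trop R) ^+ i =
    tpeval r`_0 u + \sum_(i < k) tpeval r`_i.+1 u * (Some t : trop R) ^+ i.+1.
  move=> rk.
  have -> : tpeval r`_0 u = tpeval r`_0 u * (Some t : trop R) ^+ 0.
    by rewrite expr0 mulr1.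
  rewrite -(big_ord_recl k (fun i : 'I_k.+1 => tpeval r`_i u * (Some t : trop R) ^+ i)) /=.
  rewrite (big_ord_widen k.+1 (fun i => tpeval r`_i u * (Some t : trop R) ^+ i)) ?(leq_trans rk) //.
  rewrite [RHS](bigID (fun i : 'I_k.+1 => (i < size r)%N)) /=.
  rewrite [X in _ + X]big1 ?addr0 // => i; rewrite -leqNgt => ri.
  by rewrite nth_default // tpeval0 mul0r.
wlog: p q @k widen / (exists2 b, tpeval q`_0 u = Some b &
    forall a, tpeval p`_0 u = Some a -> a < b).
  move=> wl E.
  case pE: (tpeval p`_0 u) => [a|]; case qE: (tpeval q`_0 u) => [b|] //.
  - have [ab|ba|-> //] := ltgtP a b.
      rewrite -pE -qE; apply: wl => //.
      by exists b => // c; rewrite pE => -[<-].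
    rewrite -pE -qE; apply/esym; apply: wl => //.
      by move=> r t; rewrite maxnC; exact: widen.
    by exists a => // c; rewrite qE => -[<-].
  - rewrite -pE -qE; apply/esym; apply: wl => //.
      by move=> r t; rewrite maxnC; exact: widen.
    by exists a => // c; rewrite qE.
  - rewrite -pE -qE; apply: wl => //.
    by exists b => // c; rewrite pE.
move=> [b qE pb] E; exfalso.
have [t0 H] := trop_sum_lt (fun i => tpeval p`_i.+1 u) b k.
have [s sb sE] := H t0 (lexx _).
have := E t0; rewrite !widen ?leq_max ?leqnn ?orbT // qE.
set P := \sum_(i < k) _ in sE *; set Q := \sum_(i < k) _.
move: pb sE; case: (tpeval p`_0 u) => [a|] pb; case: P => [x|]; case: Q => [y|] //.
- move=> [] /max_idPr xs [] /eqP; rewrite eq_le => /andP[_].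
  by rewrite ge_max leNgt gt_max pb // (le_lt_trans xs sb).
- move=> [] /max_idPr xs [] /eqP; rewrite eq_le => /andP[_].
  by rewrite leNgt gt_max pb // (le_lt_trans xs sb).
- move=> _ [] /eqP; rewrite eq_le => /andP[_].
  by rewrite ge_max leNgt pb.
- by move=> _ [] ab; have := pb a erefl; rewrite ab ltxx.
- move=> [] /max_idPr xs [] /eqP; rewrite eq_le => /andP[_].
  by rewrite ge_max leNgt (le_lt_trans xs sb).
- move=> [] /max_idPr xs [] xb.
  by have := le_lt_trans xs sb; rewrite xb ltxx.
Qed.

Lemma tpeval_ext n (p q : tpoly R n) :
  (forall u, fin_pt u -> tpeval p u = tpeval q u) -> tpeval p =1 tpeval q.
Proof.
elim: n p q => [|n IH] p q E u; first by apply: E => -[].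
case u0E: (u ord0) => [t|].
  rewrite -(tpeval_horner p u0E) -(tpeval_horner q u0E).
  apply: IH => v fv.
  pose w i := if unlift ord0 i is Some j then v j else Some t.
  have wv : v = (fun i => w (lift ord0 i)).
    by apply/funext => i; rewrite /w liftK.
  have w0 : w ord0 = Some t by rewrite /w unlift_none.
  rewrite wv !tpeval_horner //; apply: E => i.
  by rewrite /w; case: unliftP => [j _|_] //; exact: fv.
have eval0 (r : tpoly R n.+1) : tpeval r u =
    tpeval ((r : {poly tpoly R n})`_0) (fun i => u (lift ord0 i)).
  rewrite -(@tpeval_horner _ r None) //.
  have -> : tpolyC n None = 0.
    by elim: n {p q E u u0E IH r} => [//|n /= ->].
  by rewrite horner_coef0.
rewrite !eval0; apply: IH => v fv; apply: tpeval_coef0 => t.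
pose w i := if unlift ord0 i is Some j then v j else Some t.
have wv : v = (fun i => w (lift ord0 i)).
  by apply/funext => i; rewrite /w liftK.
have w0 : w ord0 = Some t by rewrite /w unlift_none.
have fw : fin_pt w.
  by move=> i; rewrite /w; case: unliftP => [j _|_] //; exact: fv.
by have := E w fw; rewrite !tpevalS w0 -wv.
Qed.

End Tpoly.

Section PolyFun.
Variables (R : realType) (n : nat).

Definition tpoly_equiv (p q : tpoly R n) : bool :=
  `[< forall u : 'I_n -> trop R, tpeval p u = tpeval q u >].

Fact tpoly_equiv_refl : reflexive tpoly_equiv.
Proof. by move=> p; apply/asboolP. Qed.
Fact tpoly_equiv_sym : symmetric tpoly_equiv.
Proof. by move=> p q; apply/asboolP/asboolP => E u. Qed.
Fact tpoly_equiv_trans : transitive tpoly_equiv.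
Proof.
by move=> p q r /asboolP E /asboolP F; apply/asboolP => u; rewrite E F.
Qed.

Canonical tpoly_equiv_rel :=
  EquivRel tpoly_equiv tpoly_equiv_refl tpoly_equiv_sym tpoly_equiv_trans.

Definition tpolyfun := {eq_quot tpoly_equiv}.

HB.instance Definition _ := EqQuotient.on tpolyfun.
HB.instance Definition _ := Choice.on tpolyfun.

Definition tfeval (f : tpolyfun) (u : 'I_n -> trop R) : trop R :=
  tpeval (repr f) u.

Lemma tfeval_pi p u : tfeval (\pi_tpolyfun p) u = tpeval p u.
Proof.
have /eqquotP/asboolP E : repr (\pi_tpolyfun p) = p %[mod tpolyfun].
  by rewrite reprK.
exact: E.
Qed.

Lemma tfeval_inj (f g : tpolyfun) : tfeval f =1 tfeval g -> f = g.
Proof.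
by move=> E; rewrite -[f]reprK -[g]reprK; apply/eqquotP/asboolP => u; exact: E.
Qed.

Definition tf_add (f g : tpolyfun) := \pi_tpolyfun (repr f + repr g).
Definition tf_mul (f g : tpolyfun) := \pi_tpolyfun (repr f * repr g).
Definition tf_zero := \pi_tpolyfun 0.
Definition tf_one := \pi_tpolyfun 1.

Fact tf_addE f g u : tfeval (tf_add f g) u = tfeval f u + tfeval g u.
Proof. by rewrite tfeval_pi tpevalD. Qed.
Fact tf_mulE f g u : tfeval (tf_mul f g) u = tfeval f u * tfeval g u.
Proof. by rewrite tfeval_pi tpevalM. Qed.
Fact tf_zeroE u : tfeval tf_zero u = 0.
Proof. by rewrite tfeval_pi tpeval0. Qed.
Fact tf_oneE u : tfeval tf_one u = 1.
Proof. by rewrite tfeval_pi tpeval1. Qed.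
Let tfE := (tf_addE, tf_mulE, tf_zeroE, tf_oneE).

Fact tf_addA : associative tf_add.
Proof. by move=> f g h; apply: tfeval_inj => u; rewrite !tfE addrA. Qed.
Fact tf_addC : commutative tf_add.
Proof. by move=> f g; apply: tfeval_inj => u; rewrite !tfE addrC. Qed.
Fact tf_add0 : left_id tf_zero tf_add.
Proof. by move=> f; apply: tfeval_inj => u; rewrite !tfE add0r. Qed.
Fact tf_mulA : associative tf_mul.
Proof. by move=> f g h; apply: tfeval_inj => u; rewrite !tfE mulrA. Qed.
Fact tf_mulC : commutative tf_mul.
Proof. by move=> f g; apply: tfeval_inj => u; rewrite !tfE mulrC. Qed.
Fact tf_mul1 : left_id tf_one tf_mul.
Proof. by move=> f; apply: tfeval_inj => u; rewrite !tfE mul1r. Qed.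
Fact tf_mulDl : left_distributive tf_mul tf_add.
Proof. by move=> f g h; apply: tfeval_inj => u; rewrite !tfE mulrDl. Qed.
Fact tf_mul0 : left_zero tf_zero tf_mul.
Proof. by move=> f; apply: tfeval_inj => u; rewrite !tfE mul0r. Qed.
Fact tf_one_neq0 : tf_one != tf_zero.
Proof.
apply/eqP => /(congr1 (fun f => tfeval f (fun=> 0))).
by rewrite !tfE => /eqP; rewrite oner_eq0.
Qed.

HB.instance Definition _ :=
  GRing.isNmodule.Build tpolyfun tf_addA tf_addC tf_add0.
HB.instance Definition _ := GRing.Nmodule_isComNzSemiRing.Build tpolyfun
  tf_mulA tf_mulC tf_mul1 tf_mulDl tf_mul0 tf_one_neq0.

Lemma tfevalD (f g : tpolyfun) u : tfeval (f + g) u = tfeval f u + tfeval g u.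
Proof. exact: tf_addE. Qed.
Lemma tfevalM (f g : tpolyfun) u : tfeval (f * g) u = tfeval f u * tfeval g u.
Proof. exact: tf_mulE. Qed.
Lemma tfeval0 u : tfeval 0 u = 0. Proof. exact: tf_zeroE. Qed.
Lemma tfeval1 u : tfeval 1 u = 1. Proof. exact: tf_oneE. Qed.

Lemma tfeval_neq0 (f : tpolyfun) u : f != 0 -> fin_pt u -> tfeval f u != 0.
Proof.
move=> /eqP f0 fu; apply/eqP => fu0; apply/f0/tfeval_inj => v.
rewrite tfeval0; apply/eqP; apply: contraTT isT => fv.
by have := tpeval_neq0 fv fu; rewrite -/(tfeval f u) fu0 eqxx.
Qed.

Lemma tpolyfun_mulfI (f : tpolyfun) : f != 0 -> injective ( *%R f).
Proof.
move=> f0 g h /(congr1 tfeval) E; apply: tfeval_inj.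
apply: tpeval_ext => u fu; apply: (trop_mulfI (tfeval_neq0 f0 fu)).
by rewrite -!/(tfeval _ u) -!tfevalM E.
Qed.

End PolyFun.

HB.mixin Record isCancellative S of GRing.ComNzSemiRing S := {
  cmulfI : forall a : S, a != 0 -> injective ( *%R a)
}.

#[short(type="cancelSemiRingType")]
HB.structure Definition CancelSemiRing :=
  { S of GRing.ComNzSemiRing S & isCancellative S }.

HB.instance Definition _ (R : realType) (n : nat) :=
  isCancellative.Build (tpolyfun R n) (@tpolyfun_mulfI R n).

(* The semifield of fractions of a cancellative commutative semiring: the
   analogue of [{fraction S}], which the library provides for domains only.  *)
Section SemiFraction.
Variable S : cancelSemiRingType.

Lemma cmul_neq0 (a b : S) : a != 0 -> b != 0 -> a * b != 0.
Proof.
move=> a0; apply: contraNN => /eqP ab.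
by apply/eqP; apply: (cmulfI _ a0); rewrite mulr0.
Qed.

Definition sratio := {x : S * S | x.2 != 0}.
HB.instance Definition _ := Choice.on sratio.
Implicit Types x y z : sratio.

Definition num x : S := (val x).1.
Definition den x : S := (val x).2.
Lemma den_neq0 x : den x != 0. Proof. exact: valP x. Qed.

Definition mk_sratio (a b : S) (b0 : b != 0) : sratio :=
  exist (fun x : S * S => x.2 != 0) (a, b) b0.

Definition sratio_equiv x y : bool := num x * den y == num y * den x.

Fact sratio_equiv_refl : reflexive sratio_equiv.
Proof. by move=> x; rewrite /sratio_equiv. Qed.
Fact sratio_equiv_sym : symmetric sratio_equiv.
Proof. by move=> x y; rewrite /sratio_equiv eq_sym. Qed.
Fact sratio_equiv_trans : transitive sratio_equiv.
Proof.
move=> y x z /eqP E /eqP F; apply/eqP; apply: (cmulfI _ (den_neq0 y)).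
by rewrite mulrA [X in X * _]mulrC E mulrAC F -mulrA mulrCA.
Qed.

Canonical sratio_equiv_rel := EquivRel sratio_equiv
  sratio_equiv_refl sratio_equiv_sym sratio_equiv_trans.

Definition sfrac := {eq_quot sratio_equiv}.

HB.instance Definition _ := EqQuotient.on sfrac.
HB.instance Definition _ := Choice.on sfrac.
Implicit Types f g h : sfrac.

Definition mkfrac (a b : S) (b0 : b != 0) : sfrac :=
  \pi_sfrac (mk_sratio a b0).

Lemma mkfrac_eq a b (b0 : b != 0) c d (d0 : d != 0) :
  mkfrac a b0 = mkfrac c d0 <-> a * d = c * b.
Proof.
split=> [/eqquotP/eqP //|E]; exact/eqquotP/eqP.
Qed.

Lemma mkfrac_repr f : mkfrac (num (repr f)) (den_neq0 (repr f)) = f.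
Proof.
by rewrite /mkfrac -[RHS]reprK; congr (\pi_sfrac _); apply: val_inj => /=;
  rewrite /num /den -surjective_pairing.
Qed.

Lemma sfracP f : exists a b (b0 : b != 0), f = mkfrac a b0.
Proof.
exists (num (repr f)), (den (repr f)), (den_neq0 (repr f)).
by rewrite mkfrac_repr.
Qed.

Lemma repr_mkfrac a b (b0 : b != 0) :
  num (repr (mkfrac a b0)) * b = a * den (repr (mkfrac a b0)).
Proof. by apply/(mkfrac_eq _ (den_neq0 _) _ b0); rewrite mkfrac_repr. Qed.

Definition sf_add f g : sfrac :=
  let x := repr f in let y := repr g in
  mkfrac (num x * den y + num y * den x) (cmul_neq0 (den_neq0 x) (den_neq0 y)).
Definition sf_mul f g : sfrac :=
  let x := repr f in let y := repr g in
  mkfrac (num x * num y) (cmul_neq0 (den_neq0 x) (den_neq0 y)).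
Definition sf_zero : sfrac := mkfrac 0 (oner_neq0 S).
Definition sf_one : sfrac := mkfrac 1 (oner_neq0 S).


Lemma sf_add_mkfrac a b (b0 : b != 0) c d (d0 : d != 0) :
  sf_add (mkfrac a b0) (mkfrac c d0) =
  mkfrac (a * d + c * b) (cmul_neq0 b0 d0).
Proof.
rewrite /sf_add; apply/mkfrac_eq; have := repr_mkfrac a b0.
have := repr_mkfrac c d0; move: (num _) (den _) => n2 d2 E2.
move: (num _) (den _) => n1 d1 E1.
have -> : (n1 * d2 + n2 * d1) * (b * d) =
  (n1 * b) * d2 * d + (n2 * d) * d1 * b by ring.
by rewrite E1 E2; ring.
Qed.

Lemma sf_mul_mkfrac a b (b0 : b != 0) c d (d0 : d != 0) :
  sf_mul (mkfrac a b0) (mkfrac c d0) = mkfrac (a * c) (cmul_neq0 b0 d0).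
Proof.
rewrite /sf_mul; apply/mkfrac_eq; have := repr_mkfrac a b0.
have := repr_mkfrac c d0; move: (num _) (den _) => n2 d2 E2.
move: (num _) (den _) => n1 d1 E1.
have -> : n1 * n2 * (b * d) = (n1 * b) * (n2 * d) by ring.
by rewrite E1 E2; ring.
Qed.

Let sfE := (sf_add_mkfrac, sf_mul_mkfrac).

Fact sf_addA : associative sf_add.
Proof.
move=> f g h; have [a [b [b0 ->]]] := sfracP f.
have [c [d [d0 ->]]] := sfracP g; have [e [k [k0 ->]]] := sfracP h.
by rewrite !sfE; apply/mkfrac_eq; ring.
Qed.
Fact sf_addC : commutative sf_add.
Proof.
move=> f g; have [a [b [b0 ->]]] := sfracP f.
have [c [d [d0 ->]]] := sfracP g.
by rewrite !sfE; apply/mkfrac_eq; ring.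
Qed.
Fact sf_add0 : left_id sf_zero sf_add.
Proof.
move=> f; have [a [b [b0 ->]]] := sfracP f.
by rewrite !sfE; apply/mkfrac_eq; ring.
Qed.
Fact sf_mulA : associative sf_mul.
Proof.
move=> f g h; have [a [b [b0 ->]]] := sfracP f.
have [c [d [d0 ->]]] := sfracP g; have [e [k [k0 ->]]] := sfracP h.
by rewrite !sfE; apply/mkfrac_eq; ring.
Qed.
Fact sf_mulC : commutative sf_mul.
Proof.
move=> f g; have [a [b [b0 ->]]] := sfracP f.
have [c [d [d0 ->]]] := sfracP g.
by rewrite !sfE; apply/mkfrac_eq; ring.
Qed.
Fact sf_mul1 : left_id sf_one sf_mul.
Proof.
move=> f; have [a [b [b0 ->]]] := sfracP f.
by rewrite !sfE; apply/mkfrac_eq; ring.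
Qed.
Fact sf_mulDl : left_distributive sf_mul sf_add.
Proof.
move=> f g h; have [a [b [b0 ->]]] := sfracP f.
have [c [d [d0 ->]]] := sfracP g; have [e [k [k0 ->]]] := sfracP h.
by rewrite !sfE; apply/mkfrac_eq; ring.
Qed.
Fact sf_mul0 : left_zero sf_zero sf_mul.
Proof.
move=> f; have [a [b [b0 ->]]] := sfracP f.
by rewrite !sfE; apply/mkfrac_eq; ring.
Qed.
Fact sf_one_neq0 : sf_one != sf_zero.
Proof.
by apply/eqP => /mkfrac_eq /eqP; rewrite mul1r mul0r oner_eq0.
Qed.

HB.instance Definition _ :=
  GRing.isNmodule.Build sfrac sf_addA sf_addC sf_add0.
HB.instance Definition _ := GRing.Nmodule_isComNzSemiRing.Build sfrac
  sf_mulA sf_mulC sf_mul1 sf_mulDl sf_mul0 sf_one_neq0.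

Lemma mkfracD a b (b0 : b != 0) c d (d0 : d != 0) :
  mkfrac a b0 + mkfrac c d0 = mkfrac (a * d + c * b) (cmul_neq0 b0 d0).
Proof. exact: sf_add_mkfrac. Qed.

Lemma mkfracM a b (b0 : b != 0) c d (d0 : d != 0) :
  mkfrac a b0 * mkfrac c d0 = mkfrac (a * c) (cmul_neq0 b0 d0).
Proof. exact: sf_mul_mkfrac. Qed.

Lemma mkfrac_eq0 a b (b0 : b != 0) : (mkfrac a b0 == 0) = (a == 0).
Proof.
apply/eqP/eqP => [/mkfrac_eq|->]; first by rewrite mulr1 mul0r.
by apply/mkfrac_eq; rewrite !mul0r.
Qed.

Lemma sfrac_inv f : f != 0 -> exists g, f * g = 1.
Proof.
have [a [b [b0 ->]]] := sfracP f; rewrite mkfrac_eq0 => a0.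
by exists (mkfrac b a0); rewrite mkfracM; apply/mkfrac_eq; ring.
Qed.

End SemiFraction.

Definition tratfun (R : realType) (n : nat) : comNzSemiRingType :=
  sfrac (tpolyfun R n).

Definition trop_pt (R : realType) (n : nat) (x : 'rV[R]_n) : 'I_n -> trop R :=
  fun i => Some (x ord0 i).

(* The function R^n -> T of a tropical rational function f1 / f2, namely
   x |-> f1(x) - f2(x), by choosing some representative; [treval_mkfrac] shows
   that the choice is irrelevant, and [treval_eq0] that the values are real
   unless f is the constant -oo.                                             *)
Definition treval (R : realType) (n : nat) (f : tratfun R n) (x : 'rV[R]_n) :
    trop R :=
  tfeval (num (repr f)) (trop_pt x) *
  trop_inv (tfeval (den (repr f)) (trop_pt x)).

Section TratfunEval.
Variables (R : realType) (n : nat).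
Implicit Types (f g : tratfun R n) (x : 'rV[R]_n).

Lemma trop_pt_fin x : fin_pt (trop_pt x). Proof. by []. Qed.

Lemma treval_mkfrac (a b : tpolyfun R n) (b0 : b != 0) x :
  treval (mkfrac a b0) x =
  tfeval a (trop_pt x) * trop_inv (tfeval b (trop_pt x)).
Proof.
rewrite /treval; set r := repr _.
have /(congr1 (fun h : tpolyfun R n => tfeval h (trop_pt x))) := repr_mkfrac a b0.
rewrite -/r !tfevalM => E.
have bx := tfeval_neq0 b0 (trop_pt_fin x).
have dx := tfeval_neq0 (den_neq0 r) (trop_pt_fin x).
apply: (trop_mulfI bx); apply: (trop_mulfI dx).
move: E bx dx; move: (tfeval (num r) _) (tfeval (den r) _) => p q.
move: (tfeval a _) (tfeval b _) => u v E v0 q0.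
have -> : q * (v * (p * trop_inv q)) = (p * v) * (q * trop_inv q) by ring.
rewrite E trop_mulfV // mulr1.
have -> : q * (v * (u * trop_inv v)) = u * q * (v * trop_inv v) by ring.
by rewrite trop_mulfV // mulr1.
Qed.

Lemma treval_eq0 f x : (treval f x == 0) = (f == 0).
Proof.
have [a [b [b0 ->]]] := sfracP f; rewrite treval_mkfrac mkfrac_eq0.
have bx := tfeval_neq0 b0 (trop_pt_fin x).
rewrite trop_mul_eq0; have -> : (trop_inv (tfeval b (trop_pt x)) == 0) = false.
  by case: (tfeval b _) bx.
rewrite orbF; apply/idP/idP => [|/eqP ->]; last by rewrite tfeval0.
by apply: contraTT => a0; exact: tfeval_neq0.
Qed.

Lemma trevalD f g x : treval (f + g) x = treval f x + treval g x.
Proof.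
have [a [b [b0 ->]]] := sfracP f; have [c [d [d0 ->]]] := sfracP g.
rewrite mkfracD !treval_mkfrac tfevalD !tfevalM trop_invM.
have bx := tfeval_neq0 b0 (trop_pt_fin x).
have dx := tfeval_neq0 d0 (trop_pt_fin x).
move: (tfeval a _) (tfeval b _) (tfeval c _) (tfeval d _) bx dx.
move=> p q u v q0 v0.
have -> : (p * v + u * q) * (trop_inv q * trop_inv v) =
  p * trop_inv q * (v * trop_inv v) + u * trop_inv v * (q * trop_inv q) by ring.
by rewrite !trop_mulfV // !mulr1.
Qed.

Lemma trevalM f g x : treval (f * g) x = treval f x * treval g x.
Proof.
have [a [b [b0 ->]]] := sfracP f; have [c [d [d0 ->]]] := sfracP g.
by rewrite mkfracM !treval_mkfrac !tfevalM trop_invM; ring.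
Qed.

Lemma treval_inj f g : treval f =1 treval g -> f = g.
Proof.
have [a [b [b0 ->]]] := sfracP f; have [c [d [d0 ->]]] := sfracP g => E.
apply/mkfrac_eq/tfeval_inj/tpeval_ext => u fu.
pose x : 'rV[R]_n := \row_i odflt 0 (u i).
have ux : u = trop_pt x.
  by apply/funext => i; rewrite /trop_pt mxE; case: (u i) (fu i).
have := E x; rewrite -!/(tfeval _ u) !treval_mkfrac !tfevalM -ux.
have bu := tfeval_neq0 b0 fu; have du := tfeval_neq0 d0 fu.
move: (tfeval a _) (tfeval b _) (tfeval c _) (tfeval d _) bu du.
move=> p q r s q0 s0 H.
have -> : p * s = p * trop_inv q * q * s.
  by rewrite -[p * _ * q]mulrA [trop_inv q * q]mulrC trop_mulfV ?mulr1.
rewrite H.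
have -> : r * trop_inv s * q * s = r * q * (s * trop_inv s) by ring.
by rewrite trop_mulfV ?mulr1.
Qed.

End TratfunEval.

Definition congruence (S : pzSemiRingType) (E : set (S * S)) : Prop :=
  [/\ forall a, E (a, a),
      forall a b, E (a, b) -> E (b, a),
      forall a b c, E (a, b) -> E (b, c) -> E (a, c),
      forall a b c d, E (a, b) -> E (c, d) -> E (a + c, b + d)
    & forall a b c d, E (a, b) -> E (c, d) -> E (a * c, b * d)].

Definition finitely_generated_congruence (S : pzSemiRingType)
    (E : set (S * S)) : Prop :=
  exists2 A : set (S * S), finite_set A & E = smallest (@congruence S) A.

(* [smallest] is an intersection, so it has to be checked that it is itself a
   congruence.                                                               *)
Lemma smallest_congruence (S : pzSemiRingType) (A : set (S * S)) :
  congruence (smallest (@congruence S) A).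
Proof.
split.
- by move=> a C [[]].
- by move=> a b ab C CA; case: (CA) => -[_ sy _ _ _] _; exact: sy (ab C CA).
- move=> a b c ab bc C CA; case: (CA) => -[_ _ tr _ _] _.
  exact: tr (ab C CA) (bc C CA).
- move=> a b c d ab cd C CA; case: (CA) => -[_ _ _ ad _] _.
  exact: ad (ab C CA) (cd C CA).
- move=> a b c d ab cd C CA; case: (CA) => -[_ _ _ _ mu] _.
  exact: mu (ab C CA) (cd C CA).
Qed.

Definition congruence_of (R : realType) (n : nat) (V : set 'rV[R]_n) :
    set (tratfun R n * tratfun R n) :=
  [set fg | forall x, V x -> treval fg.1 x = treval fg.2 x].

Definition congruence_variety (R : realType) (n : nat)
    (E : set (tratfun R n * tratfun R n)) : set 'rV[R]_n :=
  [set x | forall fg, E fg -> treval fg.1 x = treval fg.2 x].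

(* Main.v *)
Require Import Defs.
From mathcomp Require Import all_boot all_order all_algebra.
From mathcomp Require Import all_classical all_reals.
From mathcomp Require Import ring lra.

(** The variety [V] of a finitely generated congruence is the set where finitely
    many pairs of tropical rational functions agree.  If [V] is empty, its
    congruence is everything and is generated by the pair [(-oo, 0)].

    Otherwise [V] is a sublevel set [h <= 0] of one tropical rational function
    ([agreement_set_sublevel]).  As [h] is a maximum of affine functions [p]
    minus a maximum of affine functions [q], [V] is the union over [q] of the
    polyhedra where all [p - q] are nonpositive.  For a nonempty polyhedron, the
    positive part of [max_p (p - q)] is a tropical rational function that
    vanishes on the polyhedron and, by Hoffman's error bound ([hoffman_bound]),
    is at least a constant times the distance to it.  The minimum [F] of these
    functions over the nonempty polyhedra is then a tropical rational function
    that vanishes on [V] and dominates a multiple of the distance to [V]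
    ([gauge_sublevel]).

    Every real-valued tropical rational function is Lipschitz
    ([rval_lipschitz]), so one that vanishes on [V] has absolute value at most
    [N F] for some integer [N].  Since the class of the unit of a congruence is
    convex for the order ([congruence_order_convex]), such a function is
    identified with 1 as soon as [F] is; passing to quotients, the single pair
    [(F, 1)] generates the congruence of [V] ([gauge_generates]). *)

Set Implicit Arguments.
Unset Strict Implicit.
Unset Printing Implicit Defensive.

Import Order.TTheory GRing.Theory Num.Theory.

Local Open Scope ring_scope.
Local Open Scope classical_set_scope.
Local Open Scope quotient_scope.

(** * A Hoffman bound for systems of affine inequalities *)

Section AffineHoffman.
Variables (R : realFieldType) (n : nat).
Implicit Types (c : 'rV[R]_n * R) (x y : 'rV[R]_n) (s : seq ('rV[R]_n * R)).
Implicit Types d : R.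

Definition aff c x : R := \sum_i c.1 ord0 i * x ord0 i + c.2.

(** Nonnegativity of [d] is automatic unless [n = 0]; it is imposed so that the
    bounds below can be multiplied and added without a case distinction. *)
Definition sup_close d x y := 0 <= d /\ forall i, `|x ord0 i - y ord0 i| <= d.

Lemma aff_comb c c' (a b : R) x :
  aff (a *: c.1 + b *: c'.1, a * c.2 + b * c'.2) x = a * aff c x + b * aff c' x.
Proof.
rewrite /aff /= !mulrDr addrACA; congr (_ + _).
rewrite !mulr_sumr -big_split /=; apply: eq_bigr => i _.
by rewrite !mxE mulrDl !mulrA.
Qed.

Lemma aff_lipschitz c x y d : sup_close d x y ->
  `|aff c x - aff c y| <= (\sum_i `|c.1 ord0 i|) * d.
Proof.
move=> [d0 xy]; rewrite /aff opprD addrACA subrr addr0 -sumrB mulr_suml.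
apply: le_trans (ler_norm_sum _ _ _) _; apply: ler_sum => i _.
by rewrite -mulrBr normrM ler_wpM2l.
Qed.

Lemma ler_sum_mem (T : eqType) (s : seq T) (F : T -> R) t :
  (forall t, 0 <= F t) -> t \in s -> F t <= \sum_(u <- s) F u.
Proof.
by move=> F0 ts; rewrite (big_rem t) //= lerDl sumr_ge0.
Qed.

Lemma ler_norm_maxB (a a' b b' u v : R) : 0 <= u -> 0 <= v ->
  `|a - a'| <= u -> `|b - b'| <= v ->
  `|Num.max a b - Num.max a' b'| <= u + v.
Proof.
rewrite !ler_norml => u0 v0 /andP[? ?] /andP[? ?].
by case: (leP b a); case: (leP b' a') => ? ?; apply/andP; split; lra.
Qed.

(** The point is [x] clamped between the lower bounds [b] and the upper bounds
    [a]: clamping moves [x] by no more than the amount by which it violates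
    them. *)
Lemma exists_between_near (I : eqType) (s t : seq I) (a b : I -> R) (x d : R) :
  0 <= d ->
  {in s, forall i, x - d <= a i} -> {in t, forall j, b j <= x + d} ->
  {in s & t, forall i j, b j <= a i} ->
  exists m, [/\ {in s, forall i, m <= a i}, {in t, forall j, b j <= m}
    & `|x - m| <= d].
Proof.
move=> d0 xa bx ba.
have [m [bm /andP[xm mx]]] : exists m, {in t, forall j, b j <= m} /\
    x <= m <= x + d.
  elim: t bx {ba} => [|j t IH] bx.
    by exists x; split=> //; rewrite lexx lerDl.
  have [|m [bm /andP[xm mx]]] := IH.
    by move=> k kt; apply: bx; rewrite inE kt orbT.
  exists (Num.max (b j) m); split.
  - by move=> k; rewrite inE le_max => /predU1P[->|/bm ->]; rewrite ?lexx ?orbT.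
  - by rewrite le_max xm orbT ge_max mx bx ?inE ?eqxx.
elim: s xa ba => [|i s IH] xa ba.
  by exists m; split => //; rewrite distrC ger0_norm; lra.
have [||p [pa bp xp]] := IH.
- by move=> k ks; apply: xa; rewrite inE ks orbT.
- by move=> k j ks jt; apply: ba => //; rewrite inE ks orbT.
exists (Num.min (a i) p); split.
- by move=> k; rewrite inE ge_min => /predU1P[->|/pa ->]; rewrite ?lexx ?orbT.
- by move=> j jt; rewrite le_min bp // ba ?inE ?eqxx.
- have := xa i; rewrite inE eqxx => /(_ isT) xai.
  move: xp; rewrite !ler_norml.
  by case: (leP (a i) p) => ? /andP[? ?]; apply/andP; split; lra.
Qed.

Definition set_coord (j : 'I_n) (t : R) x : 'rV[R]_n :=
  \row_i if i == j then t else x ord0 i.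

Lemma aff_set_coord c j t x :
  aff c (set_coord j t x) = aff c x + c.1 ord0 j * (t - x ord0 j).
Proof.
rewrite /aff (bigD1 j) //= [X in _ = X + _ + _](bigD1 j) //= mxE eqxx.
have -> : \sum_(i < n | i != j) c.1 ord0 i * set_coord j t x ord0 i =
   \sum_(i < n | i != j) c.1 ord0 i * x ord0 i.
  by apply: eq_bigr => i /negbTE ij; rewrite mxE ij.
by ring.
Qed.

(** The distance from a point to a nonempty polyhedron is at most a constant
    times the largest amount by which the point violates an inequality.  The
    proof is Fourier-Motzkin elimination, by induction on the number [k] of
    coordinates that the inequalities involve: adding each upper bound on the
    last coordinate to each lower bound on it gives a system in the remaining
    coordinates; a nearby solution of that system is then completed by clamping
    the last coordinate.  All coordinates are kept throughout, so that the
    dimension does not change during the induction. *)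
Lemma hoffman_bound k s :
  {in s, forall c (i : 'I_n), (k <= i)%N -> c.1 ord0 i = 0} ->
  (exists x, {in s, forall c, aff c x <= 0}) ->
  exists2 C, 0 <= C & forall x d, 0 <= d -> {in s, forall c, aff c x <= d} ->
    exists2 y, {in s, forall c, aff c y <= 0} & sup_close (C * d) x y.
Proof.
elim: k s => [|k IH] s sk [z sz].
  exists 0 => // x d d0 sx; exists x; last first.
    by split=> [|i]; rewrite mul0r // subrr normr0.
  move=> c cs; apply: le_trans (sz c cs); rewrite /aff.
  by rewrite !big1 // => i _; rewrite (sk c cs) ?mul0r.
have [kn|nk] := ltnP k n; last first.
  apply: IH; last by exists z.
  by move=> c cs i ki; have := leq_trans nk ki; rewrite leqNgt ltn_ord.
pose j := Ordinal kn.
pose co c := c.1 ord0 j.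
pose comb c c' : 'rV[R]_n * R :=
  ((co c)^-1 *: c.1 + (- co c')^-1 *: c'.1,
   (co c)^-1 * c.2 + (- co c')^-1 * c'.2).
pose up := [seq c <- s | 0 < co c]; pose lo := [seq c <- s | co c < 0].
pose s' := [seq c <- s | co c == 0] ++ [seq comb c c' | c <- up, c' <- lo].
have upP c : c \in up -> c \in s /\ 0 < (co c)^-1.
  by rewrite mem_filter => /andP[? ->]; rewrite invr_gt0.
have loP c : c \in lo -> c \in s /\ 0 < (- co c)^-1.
  by rewrite mem_filter => /andP[? ->]; rewrite invr_gt0 oppr_gt0.
have s'k : {in s', forall c (i : 'I_n), (k <= i)%N -> c.1 ord0 i = 0}.
  move=> c; rewrite mem_cat mem_filter.
  move=> /orP[/andP[/eqP c0 cs]|/allpairsP[[u w]] /=].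
    move=> i; rewrite leq_eqVlt => /predU1P[ki|]; last exact: sk.
    by rewrite (_ : i = j) //; apply: val_inj.
  move=> [uU wL ->] i; have [us u0] := upP u uU; have [ws w0] := loP w wL.
  rewrite !mxE /= leq_eqVlt => /predU1P[ki|ki]; last first.
    by rewrite !sk // !mulr0 addr0.
  rewrite (_ : i = j); last exact: val_inj.
  rewrite mulVf; last by rewrite -invr_eq0 gt_eqF.
  by rewrite invrN mulNr mulVf ?subrr // -oppr_eq0 -invr_eq0 gt_eqF.
(* [M] bounds the effect of normalising the eliminated coefficient to 1 or -1,
   and [L] is a common Lipschitz constant of the constraints. *)
pose M := \sum_(c <- s) `|(co c)^-1|.
have M0 : 0 <= M by exact: sumr_ge0.
have invM c : c \in s -> (co c)^-1 <= M /\ (- co c)^-1 <= M.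
  move=> cs; have : `|(co c)^-1| <= M.
    exact: (ler_sum_mem (F := fun c => `|(co c)^-1|)).
  by rewrite ler_norml invrN => /andP[]; split; lra.
pose L := \sum_(c <- s) \sum_i `|c.1 ord0 i|.
have L0 : 0 <= L by apply: sumr_ge0 => c _; exact: sumr_ge0.
have s'le x d : 0 <= d -> {in s, forall c, aff c x <= d} ->
    {in s', forall c, aff c x <= (1 + M + M) * d}.
  move=> d0 sx c; rewrite mem_cat mem_filter.
  move=> /orP[/andP[/eqP c0 cs]|/allpairsP[[u w]] /=].
    apply: le_trans (sx c cs) _.
    by rewrite -addrA mulrDl mul1r lerDl mulr_ge0 // addr_ge0.
  move=> [/upP[us u0] /loP[ws w0] ->]; rewrite aff_comb.
  have [[uM _] [_ wM]] := (invM _ us, invM _ ws).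
  have H1 : (co u)^-1 * aff u x <= M * d.
    apply: le_trans (_ : (co u)^-1 * d <= _); first by rewrite ler_pM2l ?sx.
    by rewrite ler_wpM2r.
  have H2 : (- co w)^-1 * aff w x <= M * d.
    apply: le_trans (_ : (- co w)^-1 * d <= _); first by rewrite ler_pM2l ?sx.
    by rewrite ler_wpM2r.
  by lra.
have [|C C0 HC] := IH s' s'k.
  exists z => c /(s'le z 0 (lexx _) sz); by rewrite mulr0.
pose D := C * (1 + M + M).
have D0 : 0 <= D by rewrite mulr_ge0 // !addr_ge0.
have LD0 : 0 <= M * (1 + L * D) by rewrite mulr_ge0 // addr_ge0 // mulr_ge0.
exists (D + M * (1 + L * D)); first exact: addr_ge0.
move=> x d d0 sx.
have e0 : 0 <= (1 + M + M) * d by rewrite mulr_ge0 // !addr_ge0.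
have [y ys' xy] := HC x _ e0 (s'le x d d0 sx).
rewrite mulrA -/D in xy; have [Dd0 xyi] := xy.
have := xyi j; rewrite ler_norml => /andP[xyl xyr].
(* [y] solves the eliminated system; it violates the original constraints only
   as much as [x] does, up to the Lipschitz term. *)
have affy c : c \in s -> aff c y <= (1 + L * D) * d.
  move=> cs; have := aff_lipschitz c xy; rewrite ler_norml => /andP[+ _].
  have : (\sum_i `|c.1 ord0 i|) * (D * d) <= L * (D * d).
    rewrite ler_wpM2r //.
    apply: (ler_sum_mem (F := fun c => \sum_i `|c.1 ord0 i|)) => // u.
    exact: sumr_ge0.
  by have := sx c cs; lra.
have affyM c r : c \in s -> 0 <= r <= M -> r * aff c y <= M * (1 + L * D) * d.
  move=> cs /andP[r0 rM]; apply: le_trans (ler_wpM2l r0 (affy c cs)) _.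
  by rewrite -mulrA ler_wpM2r // mulr_ge0 // addr_ge0 // mulr_ge0.
(* The bounds that the constraints put on coordinate [j] once the other
   coordinates are those of [y]. *)
have [||||t [tu tw xt]] := @exists_between_near _ up lo
   (fun c => y ord0 j - (co c)^-1 * aff c y)
   (fun c => y ord0 j + (- co c)^-1 * aff c y) (x ord0 j)
   ((D + M * (1 + L * D)) * d).
- by rewrite mulr_ge0 // addr_ge0.
- move=> u /upP[us u0].
  have : 0 <= (co u)^-1 <= M by rewrite (ltW u0); case: (invM _ us).
  by move=> /(affyM _ _ us); lra.
- move=> w /loP[ws w0].
  have : 0 <= (- co w)^-1 <= M by rewrite (ltW w0); case: (invM _ ws).
  by move=> /(affyM _ _ ws); lra.
- move=> u w uU wL.
  have : aff (comb u w) y <= 0.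
    apply: ys'; rewrite mem_cat; apply/orP; right.
    by apply/allpairsP; exists (u, w).
  by rewrite aff_comb; lra.
exists (set_coord j t y).
  move=> c cs; rewrite aff_set_coord -/(co c).
  have [c0|c0|c0] := ltgtP (co c) 0.
  - have cL : c \in lo by rewrite mem_filter c0.
    have := tw c cL; rewrite -lerBrDl => H.
    have : - co c * ((- co c)^-1 * aff c y) <= - co c * (t - y ord0 j).
      by rewrite ler_pM2l // oppr_gt0.
    by rewrite mulrA mulfV ?mul1r ?oppr_eq0 ?lt_eqF //; lra.
  - have cU : c \in up by rewrite mem_filter c0.
    have := tu c cU => H.
    have : co c * ((co c)^-1 * aff c y) <= co c * (y ord0 j - t).
      by rewrite ler_pM2l //; lra.
    by rewrite mulrA mulfV ?mul1r ?gt_eqF //; lra.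
  - rewrite c0 mul0r addr0; apply: ys'.
    by rewrite mem_cat mem_filter c0 eqxx cs.
split=> [|i]; first by apply: le_trans xt.
rewrite mxE; case: eqP => [->|_] //; apply: le_trans (xyi i) _.
by rewrite ler_wpM2r // lerDl.
Qed.

End AffineHoffman.

(** * Tropical polynomials as finite sums of affine functions *)

Section Monomials.
Variable R : realType.

Definition tpoly_affine n (p : tpoly R n) := exists c : 'rV[R]_n * R,
  forall x, tpeval p (trop_pt x) = Some (aff c x).

Lemma trop_pt_lift n (x : 'rV[R]_n.+1) :
  (fun i => trop_pt x (lift ord0 i)) = trop_pt (\row_i x ord0 (lift ord0 i)).
Proof. by apply/funext => i; rewrite /trop_pt mxE. Qed.

Lemma tpeval_polyC n (q : tpoly R n) u :
  tpeval (q%:P : tpoly R n.+1) u = tpeval q (fun i => u (lift ord0 i)).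
Proof.
rewrite -(@tpeval_horner R _ _ (u ord0)) //; congr tpeval.
exact: hornerC.
Qed.

Lemma tpeval_mulX n (p : tpoly R n.+1) u :
  tpeval ((p : {poly tpoly R n}) * 'X : tpoly R n.+1) u = tpeval p u * u ord0.
Proof.
rewrite -(@tpeval_horner R _ _ (u ord0)) // hornerMX tpevalM tpevalC.
by rewrite (@tpeval_horner R _ _ (u ord0)).
Qed.

Lemma tpoly_affineC n (q : tpoly R n) :
  tpoly_affine q -> tpoly_affine (q%:P : tpoly R n.+1).
Proof.
move=> [[a b] qE].
exists (\row_i if unlift ord0 i is Some j then a ord0 j else 0, b) => x.
rewrite tpeval_polyC trop_pt_lift qE; congr (Some (_ + _)).
rewrite big_ord_recl mxE unlift_none mul0r add0r.
by apply: eq_bigr => i _; rewrite !mxE liftK.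
Qed.

Lemma tpoly_affineMX n (p : tpoly R n.+1) :
  tpoly_affine p -> tpoly_affine ((p : {poly tpoly R n}) * 'X : tpoly R n.+1).
Proof.
move=> [[a b] pE].
exists (\row_i (a ord0 i + (i == ord0)%:R), b) => x.
rewrite tpeval_mulX pE; congr Some; rewrite /aff /=.
rewrite addrAC; congr (_ + _).
under [RHS]eq_bigr do rewrite mxE mulrDl.
rewrite big_split /=; congr (_ + _).
by rewrite big_ord_recl big1 /= ?mul1r ?addr0 // => i _; rewrite mul0r.
Qed.

(** Splitting a polynomial into its monomials, through the iterated univariate
    construction.  Only the affine shape of a monomial is recorded; the
    integrality of its slopes is carried by its being a polynomial, which lets
    quotients of monomials be used later as tropical rational functions. *)
Lemma tpoly_sum_affine n (p : tpoly R n) : exists2 s : seq (tpoly R n),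
  {in s, forall q, tpoly_affine q} & p = \sum_(q <- s) q.
Proof.
elim: n p => [|n IH] p.
  case: p => [r|]; last by exists [::]; rewrite ?big_nil.
  exists [:: (Some r : trop R)]; last by rewrite big_seq1.
  move=> q; rewrite inE => /eqP -> ; exists (0, r) => x /=.
  by rewrite /aff big_ord0 add0r.
elim/poly_ind: p => [|p c [s sA ->]]; first by exists [::]; rewrite ?big_nil.
have [t tA ->] := IH c.
exists ([seq (q : {poly tpoly R n}) * 'X | q <- s] ++ [seq q%:P | q <- t]).
  move=> q; rewrite mem_cat => /orP[|] /mapP[r rs ->].
    by apply: tpoly_affineMX; exact: sA.
  by apply: tpoly_affineC; exact: tA.
by rewrite big_cat /= !big_map -mulr_suml -rmorph_sum.
Qed.

End Monomials.

(** * The order of the tropical semifield *)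

Section TropOrder.
Variable R : realType.
Implicit Types a b c : trop R.

Definition tle a b := a + b == b.

Lemma tle0l a : tle 0 a.
Proof. by rewrite /tle add0r. Qed.

Lemma tle_Some (x y : R) : tle (Some x) (Some y) = (x <= y).
Proof.
rewrite /tle /GRing.add /=; apply/eqP/max_idPr => [[]//|->//].
Qed.

Lemma tle_addl a b c : tle (a + b) c = tle a c && tle b c.
Proof.
case: a b c => [x|] [y|] [z|]; rewrite ?add0r ?addr0 ?tle0l ?andbT //.
by rewrite !tle_Some ge_max.
Qed.

Lemma tle_addr a b c : tle a (b + c) = tle a b || tle a c.
Proof.
case: a b c => [x|] [y|] [z|]; rewrite ?add0r ?addr0 ?orbT ?orbF ?tle0l //.
by rewrite !tle_Some le_max.
Qed.

Lemma tle_suml (I : eqType) (s : seq I) (F : I -> trop R) b :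
  tle (\sum_(i <- s) F i) b <-> {in s, forall i, tle (F i) b}.
Proof.
elim: s => [|i s IH]; first by rewrite big_nil tle0l; split.
rewrite big_cons tle_addl; split=> [/andP[ib /IH sb] j|H].
  by rewrite inE => /predU1P[->|/sb].
rewrite H ?inE ?eqxx //; apply/IH => j js.
by apply: H; rewrite inE js orbT.
Qed.

Lemma tle_sumr (I : eqType) (s : seq I) (F : I -> trop R) (a : R) :
  tle (Some a) (\sum_(i <- s) F i) <-> exists2 i, i \in s & tle (Some a) (F i).
Proof.
elim: s => [|i s IH]; first by rewrite big_nil; split=> [|[]].
rewrite big_cons tle_addr; split=> [/orP[ai|/IH[j js aj]]|[j]].
- by exists i; rewrite ?inE ?eqxx.
- by exists j; rewrite ?inE ?js ?orbT.
- rewrite inE => /predU1P[->->//|js aj]; apply/orP; right.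
  by apply/IH; exists j.
Qed.

End TropOrder.

(** * Tropical rational functions as real-valued functions *)

Section RealValue.
Variables (R : realType) (n : nat).
Implicit Types (f g h p q F : tratfun R n) (x y : 'rV[R]_n) (d : R).

(** The value 0 given to the function -oo is a junk value. *)
Definition rval f x : R := odflt 0 (treval f x).

Lemma trevalE f x : f != 0 -> treval f x = Some (rval f x).
Proof. by rewrite -(treval_eq0 f x) /rval; case: (treval f x). Qed.

Lemma treval0 x : treval (0 : tratfun R n) x = 0.
Proof. by apply/eqP; rewrite treval_eq0. Qed.

Lemma treval1 x : treval (1 : tratfun R n) x = 1.
Proof.
by rewrite [LHS]treval_mkfrac tfeval1 trop_mulfV // oner_eq0.
Qed.

Lemma tratfun1_neq0 : (1 : tratfun R n) != 0.
Proof. by rewrite -(treval_eq0 _ 0) treval1 oner_eq0. Qed.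

Lemma tratfun_mul_neq0 f g : f != 0 -> g != 0 -> f * g != 0.
Proof.
move=> f0 g0; rewrite -(treval_eq0 _ 0) trevalM trop_mul_eq0 !treval_eq0.
by apply/norP; split.
Qed.

Lemma tratfun_add_neq0 f g : f != 0 -> f + g != 0.
Proof.
move=> f0; rewrite -(treval_eq0 _ 0) trevalD trop_add_eq0 !treval_eq0.
by apply/nandP; left.
Qed.

Lemma rval1 x : rval 1 x = 0.
Proof. by rewrite /rval treval1. Qed.

Lemma rvalM f g x : f != 0 -> g != 0 -> rval (f * g) x = rval f x + rval g x.
Proof. by move=> f0 g0; rewrite {1}/rval trevalM !trevalE. Qed.

Lemma rvalD f g x : f != 0 -> g != 0 ->
  rval (f + g) x = Num.max (rval f x) (rval g x).
Proof. by move=> f0 g0; rewrite {1}/rval trevalD !trevalE. Qed.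

Lemma tratfunX_neq0 f k : f != 0 -> f ^+ k != 0.
Proof.
move=> f0; elim: k => [|k IH]; first by rewrite expr0 tratfun1_neq0.
by rewrite exprS tratfun_mul_neq0.
Qed.

Lemma rvalX f k x : f != 0 -> rval (f ^+ k) x = rval f x *+ k.
Proof.
move=> f0; elim: k => [|k IH]; first by rewrite expr0 rval1.
by rewrite exprS rvalM ?tratfunX_neq0 // IH mulrS.
Qed.

Lemma rval_inj f g : f != 0 -> g != 0 -> rval f =1 rval g -> f = g.
Proof. by move=> f0 g0 E; apply: treval_inj => x; rewrite !trevalE // E. Qed.

Lemma tratfun_inv f : f != 0 ->
  exists g, [/\ g != 0, f * g = 1 & forall x, rval g x = - rval f x].
Proof.
move=> f0; have [g fg1] := sfrac_inv f0.
have g0 : g != 0.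
  by apply: contraNneq tratfun1_neq0 => g0; rewrite -[X in X == _]fg1 g0 mulr0.
exists g; split=> // x; apply/eqP; rewrite -addr_eq0 addrC -rvalM //.
by rewrite [_ * _]fg1 rval1.
Qed.

Definition affine q := exists c, forall x, treval q x = Some (aff c x).

Lemma affine_neq0 q : affine q -> q != 0.
Proof. by move=> [c qE]; rewrite -(treval_eq0 _ 0) qE. Qed.

Lemma affine_rval q : affine q -> exists c, forall x, rval q x = aff c x.
Proof. by move=> [c qE]; exists c => x; rewrite /rval qE. Qed.

Definition tpoly_frac (p : tpoly R n) : tratfun R n :=
  mkfrac (\pi_(tpolyfun R n) p) (oner_neq0 _).

Lemma treval_tpoly_frac (p : tpoly R n) x :
  treval (tpoly_frac p) x = tpeval p (trop_pt x).
Proof.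
rewrite treval_mkfrac tfeval_pi tfeval1 -[RHS]mulr1; congr (_ * _).
by rewrite -[RHS](trop_mulfV (oner_neq0 _)) mul1r.
Qed.

Lemma sum_affine_frac (p : tpoly R n) : exists2 s : seq (tratfun R n),
  {in s, forall q, affine q} & tpoly_frac p = \sum_(q <- s) q.
Proof.
have [s sA ->] := tpoly_sum_affine p.
exists [seq tpoly_frac m | m <- s].
  by move=> _ /mapP[m /sA[c mE] ->]; exists c => x; rewrite treval_tpoly_frac.
rewrite big_map; apply: treval_inj => x; rewrite treval_tpoly_frac.
elim: s {sA} => [|m s IH]; first by rewrite !big_nil tpeval0 treval0.
by rewrite !big_cons tpevalD trevalD IH treval_tpoly_frac.
Qed.

(** Every tropical rational function is a difference of two maxima of finitely
    many affine functions, each of which is again a tropical rational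
    function. *)
Lemma affine_quotient f : exists s t : seq (tratfun R n),
  [/\ {in s, forall q, affine q}, {in t, forall q, affine q},
     \sum_(q <- t) q != 0 & f * \sum_(q <- t) q = \sum_(q <- s) q].
Proof.
have [a [b [b0 ->]]] := sfracP f.
have [s sA sE] := sum_affine_frac (repr a).
have [t tA tE] := sum_affine_frac (repr b).
exists s, t; rewrite -sE -tE; split=> //.
  by rewrite mkfrac_eq0 reprK.
by rewrite [LHS]mkfracM; apply/mkfrac_eq; rewrite !reprK; ring.
Qed.

Lemma rval_lipschitz f : exists2 L, 0 <= L &
  forall x y d, sup_close d x y -> `|rval f x - rval f y| <= L * d.
Proof.
have sumL (s : seq (tratfun R n)) : {in s, forall q, affine q} ->
    exists2 L, 0 <= L & forall x y d, sup_close d x y ->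
      `|rval (\sum_(q <- s) q) x - rval (\sum_(q <- s) q) y| <= L * d.
  elim: s => [|q s IH] sA.
    exists 0 => // x y d _.
    by rewrite big_nil /rval !treval0 subrr normr0 mul0r.
  have qA : affine q by apply: sA; rewrite inE eqxx.
  have [|L L0 HL] := IH; first by move=> r rs; apply: sA; rewrite inE rs orbT.
  have [c qc] := affine_rval qA.
  have [K0 HK] : 0 <= \sum_i `|c.1 ord0 i| /\ forall x y d, sup_close d x y ->
      `|rval q x - rval q y| <= (\sum_i `|c.1 ord0 i|) * d.
    by split=> [|x y d /aff_lipschitz]; rewrite ?sumr_ge0 // !qc.
  move: (\sum_i _) K0 HK => K K0 HK.
  exists (K + L); first exact: addr_ge0.
  move=> x y d xy; have [d0 _] := xy.
  have [Ld Kd] : 0 <= L * d /\ 0 <= K * d by rewrite !mulr_ge0.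
  rewrite mulrDl big_cons; have := HK _ _ _ xy; have := HL _ _ _ xy.
  have [->|S0] := eqVneq (\sum_(j <- s) j) 0; first by rewrite addr0; lra.
  by rewrite !(rvalD _ (affine_neq0 qA) S0) => ? ?; exact: ler_norm_maxB.
have [->|f0] := eqVneq f 0.
  by exists 0 => // x y d _; rewrite /rval !treval0 subrr normr0 mul0r.
have [s [t [/sumL[L L0 HL] /sumL[K K0 HK] t0 E]]] := affine_quotient f.
exists (L + K); first exact: addr_ge0.
move=> x y d xy; have := HL _ _ _ xy; have := HK _ _ _ xy; rewrite -E !rvalM //.
by rewrite !ler_norml mulrDl => /andP[? ?] /andP[? ?]; apply/andP; split; lra.
Qed.

End RealValue.

(** * Gauges of unions of polyhedra, and the congruences they generate *)

Section Gauges.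
Variables (R : realType) (n : nat).
Implicit Types (f g h p q F G : tratfun R n) (x y : 'rV[R]_n) (d : R).
Implicit Types (s t : seq (tratfun R n)) (P Q : set 'rV[R]_n).

Lemma treval_sum s x :
  treval (\sum_(q <- s) q) x = \sum_(q <- s) treval q x.
Proof.
elim: s => [|q s IH]; first by rewrite !big_nil treval0.
by rewrite !big_cons trevalD IH.
Qed.

(** A gauge of [P] grows at least linearly with the sup-norm distance to [P],
    and in particular vanishes only on [P].  Hence it dominates, up to an integer
    factor, every Lipschitz function vanishing on [P]. *)
Definition gauge P F := [/\ F != 0, forall x, 0 <= rval F x,
  forall x, P x -> rval F x = 0 &
  exists2 C, 0 <= C & forall x, exists2 y, P y & sup_close (C * rval F x) x y].

Lemma sup_close_le x y d d' : d <= d' -> sup_close d x y -> sup_close d' x y.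
Proof.
move=> dd' [d0 xy]; split=> [|i]; first exact: le_trans dd'.
exact: le_trans (xy i) dd'.
Qed.

(** The pointwise minimum of the two gauges works; in the semifield it is
    [(F^-1 + G^-1)^-1]. *)
Lemma gauge_setU P Q F G : gauge P F -> gauge Q G ->
  exists H, gauge (P `|` Q) H.
Proof.
move=> [F0 Fge FP [C C0 HC]] [G0 Gge GQ [D D0 HD]].
have [F' [F'0 _ F'E]] := tratfun_inv F0.
have [G' [G'0 _ G'E]] := tratfun_inv G0.
have [H [H0 _ HE]] := tratfun_inv (tratfun_add_neq0 G' F'0).
have HminE x : rval H x = Num.min (rval F x) (rval G x).
  by rewrite HE (rvalD _ F'0 G'0) F'E G'E oppr_max !opprK.
exists H; split=> //.
- by move=> x; rewrite HminE le_min Fge Gge.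
- move=> x [/FP|/GQ]; rewrite HminE => ->; first by apply/min_idPl/Gge.
  by apply/min_idPr/Fge.
- exists (C + D); first exact: addr_ge0.
  move=> x; rewrite HminE; have [FG|/ltW GF] := leP (rval F x) (rval G x).
  + have [y Py xy] := HC x; exists y; first by left.
    by apply: sup_close_le xy; rewrite mulrDl lerDl mulr_ge0.
  + have [y Qy xy] := HD x; exists y; first by right.
    by apply: sup_close_le xy; rewrite mulrDl lerDr mulr_ge0.
Qed.

Lemma affine_seq s : {in s, forall q, affine q} ->
  exists cs : seq ('rV[R]_n * R), forall x v,
    {in s, forall q, rval q x <= v} <-> {in cs, forall c, aff c x <= v}.
Proof.
elim: s => [|q s IH] sA; first by exists [::].
have [|cs csE] := IH; first by move=> r rs; apply: sA; rewrite inE rs orbT.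
have [|c qE] := @affine_rval _ _ q; first by apply: sA; rewrite inE eqxx.
exists (c :: cs) => x v; split=> H.
  move=> c'; rewrite inE => /predU1P[->|].
    by rewrite -qE; apply: H; rewrite inE eqxx.
  by apply: (proj1 (csE x v)) => r rs; apply: H; rewrite inE rs orbT.
move=> r; rewrite inE => /predU1P[->|].
  by rewrite qE; apply: H; rewrite inE eqxx.
by apply: (proj2 (csE x v)) => c' cs'; apply: H; rewrite inE cs' orbT.
Qed.

(** The gauge is the positive part of the largest constraint; its growth is the
    Hoffman bound. *)
Lemma gauge_polyhedron s : {in s, forall q, affine q} ->
  (exists x, {in s, forall q, rval q x <= 0}) ->
  exists F, gauge [set x | {in s, forall q, rval q x <= 0}] F.
Proof.
move=> sA [z sz].
have [F FE] : exists F, F = 1 + \sum_(q <- s) q by exists (1 + \sum_(q <- s) q).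
have F0 : F != 0 by rewrite FE; exact: tratfun_add_neq0 (tratfun1_neq0 _ _).
have leE q x v : q \in s -> tle (treval q x) (Some v) = (rval q x <= v).
  by move=> /sA/affine_neq0 q0; rewrite (trevalE _ q0) tle_Some.
have Fle x v : (rval F x <= v) =
    (0 <= v) && tle (treval (\sum_(q <- s) q) x) (Some v).
  by rewrite -tle_Some -(trevalE _ F0) FE trevalD treval1 tle_addl tle_Some.
have Fge x : 0 <= rval F x.
  by have := lexx (rval F x); rewrite {1}Fle => /andP[].
have FleP x v : 0 <= v -> rval F x <= v <-> {in s, forall q, rval q x <= v}.
  move=> v0; rewrite Fle v0 treval_sum; split=> [/tle_suml H q qs|H].
    by rewrite -leE //; exact: H.
  by apply/tle_suml => q qs; rewrite leE //; exact: H.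
have [cs csE] := affine_seq sA.
have [||C C0 HC] := @hoffman_bound R n n cs.
- by move=> c _ i; rewrite leqNgt ltn_ord.
- by exists z; apply/csE.
exists F; split=> //.
  by move=> x sx; apply/eqP; rewrite eq_le Fge andbT; apply/FleP.
exists C => // x; have [|y ys xy] := HC x _ (Fge x).
  by apply/csE/FleP.
by exists y => //; apply/csE.
Qed.

(** The polyhedron attached to [q] is cut out by the quotients [p / q], which
    are affine.  Empty polyhedra have no gauge (there is no point to be close
    to) and are discarded one at a time. *)
Lemma gauge_bigcup_polyhedron s t :
  {in s, forall q, affine q} -> {in t, forall q, affine q} ->
  let V := [set x | exists2 q, q \in t &
    {in s, forall p, rval p x <= rval q x}] in
  V !=set0 -> exists F, gauge V F.
Proof.
move=> sA; elim: t => [|q t IH] tA V; first by case=> x [].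
have qA : affine q by apply: tA; rewrite inE eqxx.
have q0 := affine_neq0 qA; have [g [g0 qg1 gE]] := tratfun_inv q0.
pose V1 := [set x | {in [seq p * g | p <- s], forall r, rval r x <= 0}].
pose V2 := [set x | exists2 q, q \in t &
    {in s, forall p, rval p x <= rval q x}].
have V1E x : V1 x <-> {in s, forall p, rval p x <= rval q x}.
  have mE p : p \in s -> rval (p * g) x = rval p x - rval q x.
    by move=> ps; rewrite (rvalM _ (affine_neq0 (sA p ps)) g0) gE.
  split=> [H p ps|H _ /mapP[p ps ->]].
    by have := H _ (map_f _ ps); rewrite mE // subr_le0.
  by rewrite mE // subr_le0 H.
have VE : V = V1 `|` V2.
  apply/seteqP; split=> x.
    move=> [r]; rewrite inE => /predU1P[->|rt] H; last by right; exists r.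
    by left; apply/V1E.
  move=> [/V1E H|[r rt H]]; first by exists q; rewrite ?inE ?eqxx.
  by exists r; rewrite ?inE ?rt ?orbT.
have gV1 : V1 !=set0 -> exists F, gauge V1 F.
  apply: gauge_polyhedron => _ /mapP[p ps ->].
  have [[a b] pE] := sA p ps; have [[a' b'] qE] := qA.
  exists (1 *: a + (-1) *: a', 1 * b + (-1) * b') => x.
  rewrite (aff_comb (a, b) (a', b')) mul1r mulN1r.
  rewrite trevalM pE (trevalE _ g0) gE.
  by rewrite /rval qE.
have gV2 : V2 !=set0 -> exists F, gauge V2 F.
  by apply: IH => r rt; apply: tA; rewrite inE rt orbT.
rewrite VE; have [V10|/set0P/gV1[F1 F1E]] := eqVneq V1 set0.
  by rewrite V10 set0U.
have [->|/set0P/gV2[F2 F2E]] := eqVneq V2 set0.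
  by rewrite setU0; exists F1.
by move=> _; exact: gauge_setU F1E F2E.
Qed.

(** Writing [h] as [max s - max t], the condition [h <= 0] says that some
    element of [t] is above all elements of [s]. *)
Lemma gauge_sublevel h : h != 0 -> [set x | rval h x <= 0] !=set0 ->
  exists F, gauge [set x | rval h x <= 0] F.
Proof.
move=> h0; have [s [t [sA tA t0 E]]] := affine_quotient h.
have s0 : \sum_(q <- s) q != 0 by rewrite -E; exact: tratfun_mul_neq0.
rewrite (_ : mkset _ =
  [set x | exists2 q, q \in t &
    {in s, forall p, rval p x <= rval q x}]).
  exact: gauge_bigcup_polyhedron.
have hE x : (rval h x <= 0) =
    tle (treval (\sum_(q <- s) q) x) (treval (\sum_(q <- t) q) x).
  by rewrite (trevalE _ s0) (trevalE _ t0) tle_Some -E (rvalM _ h0 t0) gerDr.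
have leE x p q : p \in s -> q \in t ->
    tle (treval p x) (treval q x) = (rval p x <= rval q x).
  move=> /sA/affine_neq0 p0 /tA/affine_neq0 q0.
  by rewrite (trevalE _ p0) (trevalE _ q0) tle_Some.
apply/seteqP; split=> x /=; rewrite hE.
  rewrite (trevalE _ s0) [X in tle _ X]treval_sum => /tle_sumr[q qt].
  rewrite -(trevalE _ s0) treval_sum => /tle_suml sq; exists q => // p ps.
  by rewrite -leE // sq.
move=> [q qt sq]; rewrite (trevalE _ s0) [X in tle _ X]treval_sum.
apply/tle_sumr; exists q => //; rewrite -(trevalE _ s0) treval_sum.
by apply/tle_suml => p ps; rewrite leE ?sq.
Qed.

Lemma congruence_of_congruence P : congruence (congruence_of P).
Proof.
split.
- by move=> f x.
- by move=> f g fg x Px; rewrite (fg x Px).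
- by move=> f g h fg gh x Px; rewrite (fg x Px) (gh x Px).
- move=> f g h k fg hk x Px.
  by have := fg x Px; have := hk x Px; rewrite /= !trevalD => -> ->.
- move=> f g h k fg hk x Px.
  by have := fg x Px; have := hk x Px; rewrite /= !trevalM => -> ->.
Qed.

(** Finitely many equations [f = g] between real-valued functions amount to the
    single inequality [max |f - g| <= 0]; an equation between -oo and a
    real-valued function has no solution. *)
Lemma agreement_set_sublevel (A : seq (tratfun R n * tratfun R n)) :
  let V := [set x | {in A, forall fg, treval fg.1 x = treval fg.2 x}] in
  V = set0 \/ exists2 h, h != 0 & V = [set x | rval h x <= 0].
Proof.
elim: A => [|[f g] A IH] V.
  right; exists 1; first exact: tratfun1_neq0.
  by apply/seteqP; split=> x //= _; rewrite rval1.
pose W := [set x | {in A, forall fg, treval fg.1 x = treval fg.2 x}].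
have VE : V = [set x | treval f x = treval g x] `&` W.
  apply/seteqP; split=> x.
    move=> H; split; first by apply: (H (f, g)); rewrite inE eqxx.
    by move=> fg fgA; apply: H; rewrite inE fgA orbT.
  by move=> [E H] fg; rewrite inE => /predU1P[->|/H].
have [W0|[h h0 WE]] := IH; first by left; rewrite VE [W]W0 setI0.
have neq p q x : p != 0 -> q = 0 -> treval p x <> treval q x.
  by move=> p0 ->; rewrite treval0 => /eqP; rewrite treval_eq0; apply/negP.
have [f0|f0] := eqVneq f 0; have [g0|g0] := eqVneq g 0.
- right; exists h => //; rewrite VE f0 g0 -WE -/W.
  by apply/seteqP; split=> x // [].
- by left; rewrite VE; apply/seteqP; split=> x // [/esym /neq] /(_ g0 f0).
- by left; rewrite VE; apply/seteqP; split=> x // [/neq] /(_ f0 g0).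
have [f' [f'0 _ f'E]] := tratfun_inv f0.
have [g' [g'0 _ g'E]] := tratfun_inv g0.
have fg0 := tratfun_mul_neq0 f0 g'0; have gf0 := tratfun_mul_neq0 g0 f'0.
have k0 := tratfun_add_neq0 (g * f') fg0.
right; exists (f * g' + g * f' + h); first exact: tratfun_add_neq0 k0.
rewrite VE [W]WE; apply/seteqP.
have E x : (rval (f * g' + g * f' + h) x <= 0) =
    [&& rval f x <= rval g x, rval g x <= rval f x & rval h x <= 0].
  rewrite (rvalD _ k0 h0) (rvalD _ fg0 gf0) !ge_max.
  rewrite (rvalM _ f0 g'0) (rvalM _ g0 f'0) f'E g'E !subr_le0.
  by rewrite andbA.
split=> x; rewrite /= E (trevalE _ f0) (trevalE _ g0).
  by move=> [[->] ->]; rewrite lexx.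
by move=> /and3P[fg gf ->]; split=> //; congr Some; apply/eqP; rewrite eq_le fg.
Qed.

(** The class of 1 is convex for the order of the semifield: if [g <= F^N] then
    [g + 1] is congruent to [g + F^N = F^N], hence to 1.  Applied to [f] and to
    its inverse [g], this gives [f + 1 ~ 1] and [g + 1 ~ 1]; multiplying the
    latter by [f] gives [1 + f ~ f]. *)
Lemma congruence_order_convex
    (C : set (tratfun R n * tratfun R n)) f F (N : nat) :
  congruence C -> C (F, 1) -> f != 0 -> F != 0 ->
  (forall x, `|rval f x| <= rval F x *+ N) -> C (f, 1).
Proof.
move=> [Cr Cs Ct Ca Cm] CF f0 F0 fF.
have CFN : C (F ^+ N, 1).
  elim: N {fF} => [|N IH]; first by rewrite expr0.
  by rewrite exprS -[X in C (_, X)]mulr1; exact: Cm.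
have absorb g : g != 0 -> (forall x, rval g x <= rval F x *+ N) -> C (g + 1, 1).
  move=> g0 gF; have gFE : g + F ^+ N = F ^+ N.
    have FN0 := tratfunX_neq0 N F0.
    apply: (rval_inj _ FN0); first exact: tratfun_add_neq0 g0.
    move=> x; rewrite (rvalD _ g0 FN0); apply/max_idPr.
    by rewrite (rvalX _ _ F0).
  have := Ca _ _ _ _ (Cr g) CFN; rewrite gFE => H.
  by apply: Ct CFN; exact: Cs.
have [g [g0 fg gE]] := tratfun_inv f0.
have H1 : C (f + 1, 1).
  by apply: (absorb _ f0) => x; apply: le_trans (fF x); exact: ler_norm.
have H2 : C (g + 1, 1).
  apply: (absorb _ g0) => x; rewrite gE; apply: le_trans (fF x).
  by rewrite -normrN ler_norm.
have := Cm _ _ _ _ (Cr f) H2; rewrite mulrDr fg mulr1 addrC => /Cs H3.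
exact: Ct H3 H1.
Qed.

(** If [f] and [g] agree on [P], then [f / g] vanishes on [P] and is Lipschitz,
    so its absolute value is at most an integer multiple of the gauge.  A point
    of [P] excludes that only one of [f] and [g] is -oo. *)
Lemma gauge_generates P F : P !=set0 -> gauge P F ->
  congruence_of P = smallest (@congruence (tratfun R n)) [set (F, 1)].
Proof.
move=> [z Pz] [F0 Fge FP [C C0 HC]]; apply/seteqP; split; last first.
  apply: smallest_sub; first exact: congruence_of_congruence.
  by move=> _ -> x Px /=; rewrite (trevalE _ F0) FP // treval1.
move=> [f g] /= fgP D [Dc DF].
have {}DF : D (F, 1) by exact: DF.
have [Cr Cs Ct Ca Cm] := Dc.
have [g00|g0] := eqVneq g 0.
  have := fgP z Pz; rewrite /= g00 treval0 => /eqP.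
  by rewrite treval_eq0 => /eqP ->; exact: Cr.
have f0 : f != 0.
  by rewrite -(treval_eq0 _ z) (fgP z Pz) treval_eq0.
have [g' [g'0 gg' g'E]] := tratfun_inv g0.
have e0 := tratfun_mul_neq0 f0 g'0.
have [L L0 HL] := rval_lipschitz (f * g').
have eD : D (f * g', 1).
  apply: (congruence_order_convex (N := Num.bound (L * C)) Dc DF e0 F0) => x.
  have [y Py xy] := HC x; have := HL _ _ _ xy.
  have -> : rval (f * g') y = 0.
    by rewrite (rvalM _ f0 g'0) g'E /rval (fgP y Py) subrr.
  rewrite subr0 => /le_trans; apply; rewrite mulrA -mulr_natl ler_wpM2r //.
  by apply/ltW/archi_boundP; rewrite mulr_ge0.
have := Cm _ _ _ _ eD (Cr g).
by rewrite mul1r -mulrA [g' * g]mulrC gg' mulr1.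
Qed.

End Gauges.

Theorem corollary1p2 (R : realType) (n : nat)
    (E : set (tratfun R n * tratfun R n)) :
  congruence E ->
  finitely_generated_congruence E ->
  finitely_generated_congruence (congruence_of (congruence_variety E)).
Proof.
move=> _ [A /finite_seqP[s AE] EA].
set V := congruence_variety E.
have VE : V = [set x | {in s, forall fg, treval fg.1 x = treval fg.2 x}].
  apply/seteqP; split=> x.
    move=> Vx fg fgs; apply: Vx; rewrite EA; apply: sub_gen_smallest.
    by rewrite AE.
  move=> sx fg; rewrite EA => /(_ (congruence_of [set x])) H.
  apply: (H _ x erefl); split; first exact: congruence_of_congruence.
  by rewrite AE => hk hks _ ->; exact: sx.
(* On the empty variety every pair agrees, and identifying 0 with 1 identifies
   everything. *)
have [V0|/set0P Vne] := eqVneq V set0.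
  rewrite V0; exists [set (0, 1)]; first exact: finite_set1.
  apply/seteqP; split=> [[f g] _ C [[Cr Cs Ct Ca Cm] C01]|fg _ x //].
  have zero h : C (h, 0).
    have := Cm _ _ _ _ (Cr h) (C01 (0, 1) erefl); rewrite mulr0 mulr1.
    exact: Cs.
  by apply: Ct (zero f) (Cs _ _ (zero g)).
have [F FV] : exists F, gauge V F.
  move: Vne; rewrite VE; have [->[]//|[h h0 ->]] := agreement_set_sublevel s.
  exact: gauge_sublevel.
by exists [set (F, 1)]; [exact: finite_set1|exact: gauge_generates].
Qed.
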